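(* Let $\mathbb{F}$ be an algebraically closed field of characteristic zero, let $n,m\ge1$, let $L_{n,m}$ be the model filiform Lie superalgebra over $\mathbb{F}$ with standard basis $\{X_0,X_1,\dots,X_n\mid Y_1,\dots,Y_m\}$, and let $\mathcal{I}=\mathrm{span}_{\mathbb{F}}\{X_1,\dots,X_n\mid Y_1,\dots,Y_m\}$. Let $D:\bigwedge^{\bullet}\mathcal{I}^{*}\to\bigwedge^{\bullet}\mathcal{I}^{*}$, $D(x)=-X_0\cdot x$, and let $D_k=D|_{\bigwedge^{k}\mathcal{I}^{*}}$. Then for every integer $k\ge0$, $$\mathrm{H}^{k}(L_{n,m})=\mathrm{Ker}\,D_k\oplus\left(\mathbb{F}X_0^{*}\wedge\left(\textstyle\bigwedge^{k-1}\mathcal{I}^{*}/\mathrm{Im}\,D_{k-1}\right)\right).$$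
   Context: $L_{n,m}$ is the Lie superalgebra with even basis elements $X_0,\dots,X_n$, odd basis elements $Y_1,\dots,Y_m$, and nonzero brackets (up to skew-supersymmetry) $[X_0,X_i]=X_{i+1}$ for $1\le i\le n-1$ and $[X_0,Y_j]=Y_{j+1}$ for $1\le j\le m-1$. The subspace $\mathcal{I}$ is an abelian ideal. For a finite-dimensional Lie superalgebra $\mathfrak{g}$, $\bigwedge^{\bullet}\mathfrak{g}^{*}$ is the super-exterior algebra of the dual superspace ($\bigwedge^{k}=0$ for $k<0$). It carries a $\mathbb{Z}$-degree $\|\cdot\|$ (elements of $\mathfrak{g}^*$ have degree $1$) and a parity $|\cdot|$, and $x\wedge y=(-1)^{\|x\|\|y\|+|x||y|}y\wedge x$. If $x_1,\dots,x_a$ (even), $x_{a+1},\dots,x_{a+b}$ (odd) is a basis of $\mathfrak{g}$ with $[x_k,x_l]=\sum_i a_{kl}^i x_i$, the differential is determined by $d(1)=0$, $$d(x_i^* )=\sum_{k<l}(-1)^{|x_k||x_l|}a_{kl}^i\,x_k^*x_l^*-\tfrac12\sum_{k=a+1}^{a+b}a_{kk}^i(x_k^* )^2,\qquad d(x\wedge y)=d(x)\wedge y+(-1)^{\|x\|}x\wedge d(y).$$ $\mathrm{H}^{k}(\mathfrak{g})$ is the degree-$k$ cohomology of $(\bigwedge^{\bullet}\mathfrak{g}^*,d)$ (trivial coefficients). $X_0$ acts on $\bigwedge^{\bullet}\mathcal{I}^*$ by the natural (coadjoint) action extended as a derivation, so $D$ is the derivation with $D(X_i^* )=X_{i-1}^*$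 for $2\le i\le n$, $D(X_1^* )=0$, $D(Y_j^* )=Y_{j-1}^*$ for $2\le j\le m$, $D(Y_1^* )=0$. The identification is: $x\in\mathrm{Ker}\,D_k$ corresponds to the cohomology class of $x$, and $X_0^*\wedge\bar z$ to the cohomology class of $X_0^*\wedge z$, where $\bar z$ is the class of $z$ modulo $\mathrm{Im}\,D_{k-1}$. *)

(* Defs.v *)
From HB Require Import structures.
From mathcomp Require Import all_boot all_order all_algebra.
From mathcomp Require Import zify.

Set Implicit Arguments.
Unset Strict Implicit.
Unset Printing Implicit Defensive.

Import GRing.Theory.
Local Open Scope ring_scope.
Local Open Scope quotient_scope.

(* ring_quotient.v makes Quotient.quot U a zmodType; here it also gets the scaling. *)
Section VectorQuotient.
Variables (F : fieldType) (V : vectType F) (U : {vspace V}).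

Definition vquot := Quotient.quot U.

HB.instance Definition _ := Choice.on vquot.
HB.instance Definition _ := GRing.Zmodule.on vquot.

Definition vproj (x : V) : vquot := \pi_(Quotient.quot U) x.

Definition vquot_scale (a : F) (q : vquot) : vquot := vproj (a *: repr q).

Lemma vprojE x y : (vproj x == vproj y) = (x - y \in U).
Proof. by rewrite Quotient.idealrBE. Qed.

Lemma vprojK q : vproj (repr q) = q.
Proof. exact: reprK. Qed.

Lemma vprojD x y : vproj (x + y) = vproj x + vproj y.
Proof. by rewrite /vproj !piE. Qed.

Lemma vproj_scale a x : vproj (a *: x) = vquot_scale a (vproj x).
Proof.
apply/eqP; rewrite vprojE -scalerBr memvZ // -vprojE.
by rewrite vprojK.
Qed.

Fact vquot_scaleA a b q :
  vquot_scale a (vquot_scale b q) = vquot_scale (a * b) q.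
Proof. by rewrite -[q]vprojK -!vproj_scale scalerA. Qed.

Fact vquot_scale1 : left_id 1 vquot_scale.
Proof. by move=> q; rewrite -[q]vprojK -vproj_scale scale1r. Qed.

Fact vquot_scaleDr : right_distributive vquot_scale +%R.
Proof.
move=> a q r; rewrite -[q]vprojK -[r]vprojK.
by rewrite -vprojD -!vproj_scale scalerDr vprojD.
Qed.

Fact vquot_scaleDl q : {morph vquot_scale^~ q : a b / a + b}.
Proof. by move=> a b; rewrite -[q]vprojK -!vproj_scale scalerDl vprojD. Qed.

HB.instance Definition _ := GRing.Zmodule_isLmodule.Build F vquot
  vquot_scaleA vquot_scale1 vquot_scaleDr vquot_scaleDl.

Fact vproj_linear : linear vproj.
Proof. by move=> a x y; rewrite vprojD vproj_scale. Qed.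

HB.instance Definition _ := GRing.isLinear.Build F V vquot _ vproj vproj_linear.

End VectorQuotient.

(* The super-exterior algebra of the dual of a superspace with homogeneous    *)
(* basis x_0, ..., x_(N-1), where x_i has parity p i.  A basis of the degree  *)
(* k component is given by the monomials x_t0^* ^ ... ^ x_t(k-1)^* with t     *)
(* nondecreasing and no repeated even index; any other monomial is brought to *)
(* this form by x_i^* ^ x_j^* = (-1)^(1 + |i||j|) x_j^* ^ x_i^*.              *)
Section SuperExterior.
Variables (F : fieldType) (N : nat) (p : 'I_N -> bool).

Definition normal (t : seq 'I_N) : bool :=
  sorted (fun i j : 'I_N => (i < j)%N || (i == j) && p i) t.

Definition mono (k : nat) := {t : k.-tuple 'I_N | normal t}.

Definition ext (k : nat) : vectType F := {ffun mono k -> F^o}.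

(* Number of sign changes needed to sort t: inversions that do not involve    *)
(* two odd generators.                                                        *)
Definition inversions k (t : k.-tuple 'I_N) : nat :=
  (\sum_(a < k) \sum_(b < k | a < b)
     ((tnth t b < tnth t a) && ~~ (p (tnth t a) && p (tnth t b))))%N.

Definition ord_leq (i j : 'I_N) : bool := (i <= j)%N.

(* x_t0^* ^ ... ^ x_t(k-1)^* for an arbitrary t.  It is 0 when an even index  *)
(* is repeated, as no normal word then equals the sorted t.                   *)
Definition monom k (t : k.-tuple 'I_N) : ext k :=
  [ffun s : mono k =>
     if val s == [tuple of sort ord_leq t] then (-1) ^+ inversions t else 0].

Definition gen (i : 'I_N) : ext 1 := monom [tuple i].

Section LinearExtension.
Variables (k : nat) (V : lmodType F) (phi : k.-tuple 'I_N -> V).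

Definition linext (x : ext k) : V := \sum_(s : mono k) (x s : F) *: phi (val s).

Fact linext_linear : linear linext.
Proof.
move=> a x y; rewrite /linext scaler_sumr -big_split /=.
by apply: eq_bigr => s _; rewrite !ffunE scalerDl scalerA.
Qed.

HB.instance Definition _ :=
  GRing.isLinear.Build F (ext k) V _ linext linext_linear.

End LinearExtension.

Definition wedge k l (x : ext k) (y : ext l) : ext (k + l) :=
  linext (fun s => linext (fun t => monom [tuple of s ++ t]) y) x.

(* The k-th exterior power with k shifted by one: extpred k is the component  *)
(* of degree k - 1, which is zero for k = 0.                                  *)
Definition extpred (k : nat) : vectType F :=
  if k is k'.+1 then ext k' else 'rV[F]_0.

(* Degree-preserving derivation extending phi : x_i^* |-> phi i.              *)
Fixpoint der_monom (phi : 'I_N -> ext 1) k : k.-tuple 'I_N -> ext k :=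
  match k with
  | 0 => fun=> 0
  | k'.+1 => fun t =>
      wedge (phi (thead t)) (monom [tuple of behead t])
      + wedge (gen (thead t)) (der_monom phi [tuple of behead t])
  end.

Definition der (phi : 'I_N -> ext 1) k : 'End(ext k) :=
  linfun (linext (@der_monom phi k)).

(* Antiderivation of degree 1 extending phi : x_i^* |-> phi i.                *)
Fixpoint antider_monom (phi : 'I_N -> ext 2) k : k.-tuple 'I_N -> ext k.+1 :=
  match k with
  | 0 => fun=> 0
  | k'.+1 => fun t =>
      wedge (phi (thead t)) (monom [tuple of behead t])
      - wedge (gen (thead t)) (antider_monom phi [tuple of behead t])
  end.

Definition antider (phi : 'I_N -> ext 2) k : 'Hom(ext k, ext k.+1) :=
  linfun (linext (@antider_monom phi k)).

End SuperExterior.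

Arguments gen F {N} p i.
Arguments monom F {N} p {k} t.

(* A finite-dimensional Lie superalgebra with a homogeneous basis, given by   *)
(* its structure constants: [x_k, x_l] = \sum_i sc k l i x_i.                 *)
Record lieSuper (F : fieldType) (N : nat) := LieSuper {
  par : 'I_N -> bool;
  sc : 'I_N -> 'I_N -> 'I_N -> F;
  sc_par : forall k l i, sc k l i != 0 -> par i = par k (+) par l;
  sc_skew : forall k l i, sc l k i = - ((-1) ^+ (par k && par l) * sc k l i);
  (* [x_k, [x_l, x_q]] = [[x_k, x_l], x_q] + (-1)^(|k||l|) [x_l, [x_k, x_q]]  *)
  sc_jacobi : forall k l q i,
    \sum_r sc l q r * sc k r i =
    \sum_r sc k l r * sc r q i
    + (-1) ^+ (par k && par l) * \sum_r sc k q r * sc l r i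
}.

Section Cohomology.
Variables (F : fieldType) (N : nat) (g : lieSuper F N).

Local Notation ext := (ext F (par g)).
Local Notation extpred := (extpred F (par g)).
Local Notation gen := (gen F (par g)).

Definition dgen (i : 'I_N) : ext 2 :=
  \sum_(k < N) \sum_(l < N | (k < l)%N)
     ((-1) ^+ (par g k && par g l) * sc g k l i) *: wedge (gen k) (gen l)
  - 2%:R^-1 *: \sum_(k < N | par g k) sc g k k i *: wedge (gen k) (gen k).

Definition diff (k : nat) : 'Hom(ext k, ext k.+1) := antider dgen k.

Definition diffpred (k : nat) : 'Hom(extpred k, ext k) :=
  match k with
  | 0 => 0
  | k'.+1 => diff k'
  end.

Definition cocycles (k : nat) : {vspace ext k} := lker (diff k).
Definition coboundaries (k : nat) : {vspace ext k} := limg (diffpred k).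

(* cocycles / coboundaries, the coboundaries being pulled back to a subspace  *)
(* of the vector space of cocycles.                                           *)
Definition cohomology (k : nat) : lmodType F :=
  vquot (linfun (vsval : subvs_of (cocycles k) -> ext k)
           @^-1: coboundaries k)%VS.

(* z is a cocycle with cohomology class h                                     *)
Definition is_class k (h : cohomology k) (z : ext k) : Prop :=
  exists c : subvs_of (cocycles k), vsval c = z /\ h = vproj _ c.

End Cohomology.

(* x_0 and the subspace I spanned by the other basis elements; I is indexed   *)
(* by 'I_N through lift ord0.                                                 *)
Section Hyperplane.
Variables (F : fieldType) (N : nat) (g : lieSuper F N.+1).

Definition parI (i : 'I_N) : bool := par g (lift ord0 i).

Local Notation extI := (ext F parI).
Local Notation extpredI := (extpred F parI).

(* The algebra embedding induced by I^* -> g^*, x_i^* |-> x_i^*.              *)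
Definition incl k : extI k -> ext F (par g) k :=
  linext (fun t => monom F (par g) [tuple of map (lift ord0) t]).

(* Coadjoint action of x_0 on I^*, for even x_0:                              *)
(* (x_0 . x_i^* )(x_j) = - x_i^*([x_0, x_j]).                                 *)
Definition coad0 (i : 'I_N) : extI 1 :=
  - \sum_(j < N) sc g ord0 (lift ord0 j) (lift ord0 i) *: gen F parI j.

Definition Dmap (k : nat) : 'End(extI k) := - der coad0 k.

Definition Dpred (k : nat) : 'End(extpredI k) :=
  match k with
  | 0 => 0
  | k'.+1 => Dmap k'
  end.

(* z |-> x_0^* ^ z, for z of degree k - 1                                     *)
Definition wedge0 (k : nat) : extpredI k -> ext F (par g) k :=
  match k with
  | 0 => fun=> 0
  | k'.+1 => fun z => wedge (gen F (par g) ord0) (incl z)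
  end.

End Hyperplane.

(* L_{n,m}: X_i has index i for 0 <= i <= n, and Y_j has index n + j for      *)
(* 1 <= j <= m.                                                               *)
Section Model.
Variables (F : fieldType) (n m : nat).

Local Notation I := 'I_(n + m).+1.

Definition model_par (i : I) : bool := (n < i)%N.

(* [X_0, x_l] = x_i; l = n + m is excluded since then l.+1 is out of range.   *)
Definition model_step (l i : I) : bool :=
  ((0 < l < n) || (n < l))%N && (i == l.+1 :> nat).

Definition model_sc (k l i : I) : F :=
  (k == ord0)%:R * (model_step l i)%:R - (l == ord0)%:R * (model_step k i)%:R.

Lemma model_step0l i : model_step ord0 i = false.
Proof. by rewrite /model_step. Qed.

Lemma model_step0r l : model_step l ord0 = false.
Proof. by rewrite /model_step andbF. Qed.

Lemma model_step_par l i : model_step l i -> model_par i = model_par l.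
Proof. rewrite /model_step /model_par; lia. Qed.

Lemma model_par0 : model_par ord0 = false.
Proof. by []. Qed.

Fact model_sc_par k l i :
  model_sc k l i != 0 -> model_par i = model_par k (+) model_par l.
Proof.
rewrite /model_sc; case: (k =P ord0) => [->|_]; case: (l =P ord0) => [->|_];
  rewrite ?model_step0l ?mul0r ?mul1r ?subrr ?sub0r ?subr0 ?eqxx //.
  by case E: (model_step l i); rewrite ?eqxx // (model_step_par E).
case E: (model_step k i); rewrite ?oppr0 ?eqxx // (model_step_par E).
by rewrite model_par0 addbF.
Qed.

Fact model_sc_skew k l i :
  model_sc l k i = - ((-1) ^+ (model_par k && model_par l) * model_sc k l i).
Proof.
rewrite /model_sc; case: (k =P ord0) => [->|_]; case: (l =P ord0) => [->|_];
  rewrite ?model_par0 ?andbF /= ?expr0 ?mul1r ?opprB //.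
by rewrite !mul0r subrr mulr0 oppr0.
Qed.

Fact model_sc_comp k l q i :
  \sum_r model_sc l q r * model_sc k r i =
  (k == ord0)%:R * \sum_r model_sc l q r * (model_step r i)%:R.
Proof.
rewrite mulr_sumr; apply: eq_bigr => r _.
case: (r =P ord0) => [->|/eqP/negbTE r0].
  by rewrite /model_sc !model_step0r !(mulr0, subrr, mul0r).
by rewrite [X in _ * X]/model_sc r0 mul0r subr0 mulrCA.
Qed.

Fact model_sc_jacobi k l q i :
  \sum_r model_sc l q r * model_sc k r i =
  \sum_r model_sc k l r * model_sc r q i
  + (-1) ^+ (model_par k && model_par l)
    * \sum_r model_sc k q r * model_sc l r i.
Proof.
pose S a := \sum_r (model_step a r)%:R * (model_step r i)%:R : F.
have SE a b : \sum_r model_sc a b r * (model_step r i)%:R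
    = (a == ord0)%:R * S b - (b == ord0)%:R * S a.
  rewrite /S !mulr_sumr -sumrB; apply: eq_bigr => r _.
  by rewrite /model_sc mulrBl !mulrA.
have -> : \sum_r model_sc k l r * model_sc r q i =
    - \sum_r model_sc k l r * model_sc q r i.
  rewrite -sumrN; apply: eq_bigr => r _.
  rewrite -mulrN; congr (_ * _).
  by rewrite /model_sc opprB.
rewrite !model_sc_comp !SE.
have S0 : S ord0 = 0.
  by rewrite /S big1 // => r _; rewrite model_step0l mul0r.
case: (k =P ord0) => [->|_]; case: (l =P ord0) => [->|_];
  case: (q =P ord0) => [->|_];
  rewrite ?model_par0 ?andbF /= ?expr0 ?S0 ?(mul0r, mul1r, mulr0, subr0, sub0r,
    oppr0, add0r, addr0, opprK, subrr) //.
Qed.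

Definition model : lieSuper F (n + m).+1 :=
  LieSuper model_sc_par model_sc_skew model_sc_jacobi.

(* span{X_1, ..., X_n | Y_1, ..., Y_m} is an abelian ideal.                   *)
Lemma model_ideal k l : sc model k l ord0 = 0.
Proof. by rewrite /= /model_sc !model_step0r !mulr0 subrr. Qed.

Lemma model_abelian (k l : 'I_(n + m)) i :
  sc model (lift ord0 k) (lift ord0 l) i = 0.
Proof. by rewrite /= /model_sc /= !mul0r subrr. Qed.

End Model.

(* Main.v *)
(* Write x_0 = X_0 and I for the abelian ideal.  Since x_0 is even, every      *)
(* element of the super-exterior algebra of g^* is uniquely x + x_0^* ^ z with *)
(* x and z over I^*.  As d(x_i^* ) = x_0^* ^ D(x_i^* ) and x_0^* ^ x_0^* = 0,  *)
(* d(x + x_0^* ^ z) = x_0^* ^ D x.  Hence the cocycles are given by D x = 0    *)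
(* and the coboundaries are the x_0^* ^ z with z in the image of D.            *)
From HB Require Import structures.
Require Import Defs.
From mathcomp Require Import all_boot all_order all_algebra.
From mathcomp Require Import zify.

Set Implicit Arguments.
Unset Strict Implicit.
Unset Printing Implicit Defensive.

Import GRing.Theory.
Local Open Scope ring_scope.

(** As x_0 is even, a normal word contains the letter [ord0] at most once, and then in front; so the
    algebra of g^* is that of I^* plus its multiple by x_0^*, as a direct sum ([projK]). On the
    generators of I^*, d is x_0^* ^ D. In the product rule the minus sign of the antiderivation
    cancels the one from moving x_0^* past a generator, so d = x_0^* ^ D on the whole algebra of I^*
    ([diff_incl]), while d kills every x_0^* ^ z ([diff_wedge0]). Since z |-> x_0^* ^ z is injective
    there, the cocycles are Ker D plus all x_0^* ^ z, the coboundaries are x_0^* ^ Im D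
    ([cocycle_incl], [coboundaryP]), and the quotient is Ker D plus a copy of Coker D from one
    degree lower. The argument is carried out for an abelian ideal complementary to an even x_0
    ([abelian_ideal_cohomology]) and then applied to the model. *)

(** * Words, signs and monomials in a super-exterior algebra *)

Section Monomials.
Variables (F : fieldType) (N : nat) (p : 'I_N -> bool).

Local Notation ext := (ext F p).
Local Notation monom := (monom F p).
Local Notation gen := (gen F p).
Local Notation normal := (normal p).
Local Notation sortt t := [tuple of sort (@ord_leq N) t].

Lemma ord_leq_trans : transitive (@ord_leq N).
Proof. by move=> j i l; apply: leq_trans. Qed.

Lemma ord_leq_anti : antisymmetric (@ord_leq N).
Proof. by move=> i j ij; apply/val_inj/anti_leq. Qed.

Lemma ord_leq_total : total (@ord_leq N).
Proof. by move=> i j; apply: leq_total. Qed.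

Lemma sort_ord_leq_id (t : seq 'I_N) :
  sorted (@ord_leq N) t -> sort (@ord_leq N) t = t.
Proof. exact: (sorted_sort ord_leq_trans). Qed.

Lemma normal_sorted (t : seq 'I_N) : normal t -> sorted (@ord_leq N) t.
Proof.
apply: sub_sorted => i j /orP[/ltnW //|/andP[/eqP -> _]].
exact: leqnn.
Qed.

Lemma normal_behead (i : 'I_N) (t : seq 'I_N) : normal (i :: t) -> normal t.
Proof. exact: path_sorted. Qed.

Lemma inversions_cons k i (t : k.-tuple 'I_N) :
  inversions p [tuple of i :: t] =
  (count (fun j : 'I_N => (j < i) && ~~ (p i && p j)) t + inversions p t)%N.
Proof.
rewrite /inversions big_ord_recl; congr (_ + _)%N.
  rewrite big_mkcond big_ord_recl /= add0n -sum1_count big_tuple [RHS]big_mkcond.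
  by apply: eq_bigr => b _; rewrite tnth0 tnthS; case: ifP.
apply: eq_bigr => a _; rewrite big_mkcond big_ord_recl /= add0n [RHS]big_mkcond.
by apply: eq_bigr => b _; rewrite !tnthS.
Qed.

Lemma inversions_normal k (t : k.-tuple 'I_N) :
  normal t -> inversions p t = 0%N.
Proof.
elim: k t => [|k IH] t; first by rewrite /inversions big_ord0.
case/tupleP: t => i t nt; rewrite inversions_cons IH ?(normal_behead nt) // addn0.
have /(order_path_min ord_leq_trans)/allP it : path (@ord_leq N) i t.
  exact: (normal_sorted nt).
apply/eqP; rewrite -leqn0 leqNgt -has_count; apply/hasPn => j /it.
by rewrite /ord_leq leqNgt => /negbTE ->.
Qed.

Lemma monom_normal k (t : k.-tuple 'I_N) :
  normal t -> monom t = [ffun s : mono p k => (val s == t)%:R].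
Proof.
move=> nt; apply/ffunP => s; rewrite !ffunE inversions_normal // expr0.
have -> : sortt t = t by apply/val_inj/sort_ord_leq_id/normal_sorted.
by case: eqP.
Qed.

Lemma monom_mono k (s r : mono p k) : monom (val s) r = (r == s)%:R.
Proof. by rewrite monom_normal ?(valP s) // ffunE. Qed.

Lemma ext_expand k (x : ext k) : x = \sum_s (x s : F) *: monom (val s).
Proof.
apply/ffunP => r; rewrite sum_ffunE (bigD1 r) //= big1 ?addr0.
  by rewrite [RHS]ffunE monom_mono eqxx [RHS]mulr1.
by move=> s sr; rewrite ffunE monom_mono eq_sym (negbTE sr) scaler0.
Qed.

(** [linext] reads [phi] on normal words only; any other word contributes through its sorted form
    with the sorting sign, or vanishes when an even letter repeats. *)
Lemma linext_monom k (V : lmodType F) (phi : k.-tuple 'I_N -> V) (t : k.-tuple 'I_N) :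
  linext phi (monom t : ext k) =
  if normal (sortt t) then (-1) ^+ inversions p t *: phi (sortt t) else 0.
Proof.
rewrite /linext; case: ifP => [nt|/negbT nt].
  rewrite (bigD1 (exist _ (sortt t) nt : mono p k)) //= big1 ?addr0.
    by rewrite ffunE eqxx.
  by move=> s; rewrite -val_eqE /= ffunE => /negbTE ->; rewrite scale0r.
rewrite big1 // => s _; rewrite ffunE; case: eqP => [e|]; last by rewrite scale0r.
by case/negP: nt; rewrite -e (valP s).
Qed.

Lemma linext_normal k (V : lmodType F) (phi : k.-tuple 'I_N -> V) (t : k.-tuple 'I_N) :
  normal t -> linext phi (monom t : ext k) = phi t.
Proof.
move=> nt; rewrite linext_monom.
have -> : sortt t = t by apply/val_inj/sort_ord_leq_id/normal_sorted.
by rewrite nt inversions_normal // expr0 scale1r.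
Qed.

Lemma linext_id k (x : ext k) : linext (fun t => monom t : ext k) x = x.
Proof. by rewrite [RHS]ext_expand. Qed.

Lemma monom_sort k (t : k.-tuple 'I_N) :
  monom t =
  if normal (sortt t) then (-1) ^+ inversions p t *: monom (sortt t) else 0.
Proof. by rewrite -linext_monom linext_id. Qed.

(** Normal monomials span, so linear identities need checking on them only. This matters because
    [der] and [antider] agree with their recursive formulas by definition just on normal words. *)
Lemma ext_ind k (P : ext k -> Prop) :
  (forall a x y, P x -> P y -> P (a *: x + y)) -> P 0 ->
  (forall t : k.-tuple 'I_N, normal t -> P (monom t)) -> forall x, P x.
Proof.
move=> Plin P0 Pmonom x; rewrite [x]ext_expand.
elim/big_rec: _ => // s y _ Py; apply: Plin Py.
exact: Pmonom (valP s).
Qed.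

Lemma wedge_linear k l (x : ext k) : linear (@wedge F N p k l x).
Proof.
move=> a y z.
have wE w : wedge x w = \sum_s (x s : F) *:
  linext (fun t => monom [tuple of val s ++ t]) w by [].
rewrite !wE scaler_sumr -big_split /=.
by apply: eq_bigr => s _; rewrite linearP scalerDr !scalerA mulrC.
Qed.

HB.instance Definition _ k l (x : ext k) :=
  GRing.isLinear.Build F (ext l) (ext (k + l)) _ (@wedge F N p k l x)
    (wedge_linear x).

Lemma wedge_genl k i (y : ext k) :
  wedge (gen i) y = linext (fun t => monom [tuple of i :: t]) y.
Proof.
rewrite /wedge linext_normal //.
by apply: eq_bigr => t _; congr (_ *: monom _); apply/val_inj.
Qed.

Lemma wedge_gen_normal k i (t : k.-tuple 'I_N) :
  normal t -> wedge (gen i) (monom t) = monom [tuple of i :: t].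
Proof. by move=> nt; rewrite wedge_genl linext_normal. Qed.

Lemma wedge_suml k l (I : finType) (c : I -> F) (x : I -> ext k) (y : ext l) :
  wedge (\sum_i c i *: x i) y = \sum_i c i *: wedge (x i) y.
Proof.
by rewrite /wedge linear_sum; apply: eq_bigr => i _; rewrite linearZ.
Qed.

Lemma wedgeNl k l (x : ext k) (y : ext l) : wedge (- x) y = - wedge x y.
Proof. by rewrite /wedge linearN. Qed.

(** Both words have the same sorted form, and the out-of-order pair in front accounts for exactly
    one further inversion. *)
Lemma monom_swap k (i j : 'I_N) (t : k.-tuple 'I_N) : (j < i)%N -> ~~ (p i && p j) ->
  monom [tuple of [:: i, j & t]] = - monom [tuple of [:: j, i & t]].
Proof.
move=> ji pij; rewrite monom_sort [in RHS]monom_sort.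
have <- : sortt [tuple of [:: i, j & t]] = sortt [tuple of [:: j, i & t]].
  apply/val_inj/(perm_sortP ord_leq_total ord_leq_trans ord_leq_anti).
  by rewrite -[[:: i, j & t]]/([:: i] ++ [:: j] ++ t) perm_catCA.
case: ifP => _; last by rewrite oppr0.
have -> : inversions p [tuple of [:: i, j & t]] =
          (inversions p [tuple of [:: j, i & t]]).+1.
  rewrite (inversions_cons i [tuple of j :: t]) (inversions_cons j [tuple of i :: t]).
  by rewrite !inversions_cons /= ji pij (ltnNge i j) (ltnW ji) /=; lia.
by rewrite exprS mulN1r scaleNr.
Qed.

Lemma der_monom_cons (phi : 'I_N -> ext 1) k i (t : k.-tuple 'I_N) :
  der_monom phi [tuple of i :: t] =
  wedge (phi i) (monom t) + wedge (gen i) (der_monom phi t).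
Proof.
rewrite /= theadE; have -> // : [tuple of behead [tuple of i :: t]] = t.
exact: val_inj.
Qed.

Lemma antider_monom_cons (phi : 'I_N -> ext 2) k i (t : k.-tuple 'I_N) :
  antider_monom phi [tuple of i :: t] =
  wedge (phi i) (monom t) - wedge (gen i) (antider_monom phi t).
Proof.
rewrite /= theadE; have -> // : [tuple of behead [tuple of i :: t]] = t.
exact: val_inj.
Qed.

Lemma der_normal (phi : 'I_N -> ext 1) k (t : k.-tuple 'I_N) :
  normal t -> der phi k (monom t) = der_monom phi t.
Proof. by move=> nt; rewrite lfunE /= linext_normal. Qed.

Lemma antider_normal (phi : 'I_N -> ext 2) k (t : k.-tuple 'I_N) :
  normal t -> antider phi k (monom t) = antider_monom phi t.
Proof. by move=> nt; rewrite lfunE /= linext_normal. Qed.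

End Monomials.

(** * The embedding of the algebra of I^* and multiplication by x_0^* *)

Section Hyperplane.
Variables (F : fieldType) (N : nat) (g : lieSuper F N.+1).

Local Notation p := (par g).
Local Notation q := (parI g).
Local Notation extI := (ext F q).
Local Notation ext := (ext F p).
Local Notation gen0 := (gen F p ord0).
Local Notation emb t := [tuple of map (lift ord0) t].

Lemma sort_emb (t : seq 'I_N) :
  sort (@ord_leq N.+1) (map (lift ord0) t) = map (lift ord0) (sort (@ord_leq N) t).
Proof. by rewrite sort_map; congr map; apply: eq_sort. Qed.

Lemma normal_emb (t : seq 'I_N) : normal p (map (lift ord0) t) = normal q t.
Proof.
rewrite /normal sorted_map; apply: eq_sorted => i j /=.
by rewrite (inj_eq lift_inj).
Qed.

Lemma gt0_emb (t : seq 'I_N) :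
  all (fun j : 'I_N.+1 => 0 < j)%N (map (lift ord0) t).
Proof. by rewrite all_map; apply/allP. Qed.

Lemma sort_ord0 (t : seq 'I_N.+1) :
  sort (@ord_leq N.+1) (ord0 :: t) = ord0 :: sort (@ord_leq N.+1) t.
Proof.
apply: (sorted_eq (@ord_leq_trans _) (@ord_leq_anti _)).
- exact/sort_sorted/ord_leq_total.
- rewrite /= path_min_sorted; last exact/allP.
  exact/sort_sorted/ord_leq_total.
- by rewrite perm_sort perm_cons perm_sym perm_sort.
Qed.

Lemma normal_ord0_emb (t : seq 'I_N) :
  normal p (ord0 :: map (lift ord0) t) = normal q t.
Proof.
rewrite -normal_emb /normal /= path_min_sorted //.
by apply: sub_all (gt0_emb t) => j /= ->.
Qed.

Lemma normal_sort_ord0_emb (t : seq 'I_N) :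
  normal p (sort (@ord_leq N.+1) (ord0 :: map (lift ord0) t)) =
  normal p (sort (@ord_leq N.+1) (map (lift ord0) t)).
Proof. by rewrite sort_ord0 sort_emb normal_ord0_emb normal_emb. Qed.

Lemma inversions_emb k (t : k.-tuple 'I_N) :
  inversions p (emb t) = inversions q t.
Proof.
apply: eq_bigr => a _; apply: eq_bigr => b _.
by rewrite !tnth_map !lift0.
Qed.

Lemma inversions_ord0 k (t : k.-tuple 'I_N.+1) :
  inversions p [tuple of ord0 :: t] = inversions p t.
Proof.
by rewrite inversions_cons (eq_count (a2 := pred0)) ?count_pred0.
Qed.

(** [lift ord0] preserves order and parity, hence sorted forms, normality and signs; so the formula
    defining [incl] on normal words holds for all words. *)
Lemma incl_monom k (t : k.-tuple 'I_N) :
  incl (monom F q t) = monom F p (emb t).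
Proof.
rewrite /incl linext_monom [RHS]monom_sort.
have -> : [tuple of sort (@ord_leq N.+1) (emb t)] = emb [tuple of sort (@ord_leq N) t].
  by apply/val_inj; rewrite /= sort_emb.
by rewrite normal_emb inversions_emb.
Qed.

(** The least letter in front creates no inversion and stays in front under sorting, so no sign
    appears even if [t] is not normal. *)
Lemma wedge_gen0_emb k (t : k.-tuple 'I_N) :
  wedge gen0 (monom F p (emb t)) = monom F p [tuple of ord0 :: emb t].
Proof.
rewrite wedge_genl linext_monom [RHS]monom_sort inversions_ord0.
have -> : normal p [tuple of sort (@ord_leq N.+1) [tuple of ord0 :: emb t]] =
          normal p [tuple of sort (@ord_leq N.+1) (emb t)].
  exact: normal_sort_ord0_emb.
case: ifP => // _; congr (_ *: monom _ _ _).
by apply/val_inj; rewrite /= sort_ord0.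
Qed.

HB.instance Definition _ k := GRing.Linear.copy (@incl F N g k)
  (linext (fun t : k.-tuple 'I_N => monom F (par g) (emb t)) : extI k -> ext k).

(** An even generator anticommutes with every generator, of either parity. *)
Lemma wedge_gen_gen0 k i (w : extI k) : ~~ p ord0 ->
  wedge (gen F p (lift ord0 i)) (wedge gen0 (incl w)) =
  - wedge gen0 (incl (wedge (gen F q i) w)).
Proof.
move=> p0; elim/ext_ind: w => [a x y IHx IHy||t nt].
- by rewrite !linearP /= IHx IHy.
- by rewrite !linear0.
have n0t : normal p (ord0 :: map (lift ord0) t) by rewrite normal_ord0_emb.
rewrite incl_monom wedge_gen0_emb wedge_gen_normal // wedge_gen_normal //.
rewrite (incl_monom [tuple of i :: t]) wedge_gen0_emb monom_swap //.
  by congr (- monom _ _ _); apply/val_inj.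
by rewrite (negbTE p0) andbF.
Qed.

Lemma wedge_gen0_gen0 k (w : extI k) : ~~ p ord0 ->
  wedge gen0 (wedge gen0 (incl w)) = 0.
Proof.
move=> p0; elim/ext_ind: w => [a x y IHx IHy||t nt].
- by rewrite !linearP /= IHx IHy scaler0 addr0.
- by rewrite !linear0.
have n0t : normal p (ord0 :: map (lift ord0) t) by rewrite normal_ord0_emb.
rewrite incl_monom wedge_gen0_emb wedge_gen_normal // monom_sort ifN //.
(* The sorted word begins with two copies of the even letter [ord0], so it is not normal and its
   monomial is 0. *)
rewrite -[X in ~~ X]/(normal p (sort (@ord_leq N.+1) (ord0 :: ord0 :: emb t))).
by rewrite !sort_ord0 /normal /= (negbTE p0).
Qed.

(** * The differential for an abelian ideal complementary to an even x_0 *)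

Section AbelianIdeal.
Hypothesis p0 : ~~ p ord0.
Hypothesis ideal : forall k l, sc g k l ord0 = 0.
Hypothesis abelian : forall k l i, sc g (lift ord0 k) (lift ord0 l) i = 0.

Lemma dgen_ord0 : dgen g ord0 = 0.
Proof.
rewrite /dgen !big1 ?scaler0 ?subr0 // => k _; rewrite ?big1 ?ideal ?scale0r //.
by move=> l _; rewrite ideal mulr0 scale0r.
Qed.

(** Since I is abelian, only pairs containing x_0 contribute; the squares vanish because every odd
    generator lies in I, and the sign is trivial because x_0 is even. *)
Lemma dgen_lift i : dgen g (lift ord0 i) =
  \sum_l sc g ord0 (lift ord0 l) (lift ord0 i) *:
    wedge gen0 (gen F p (lift ord0 l)).
Proof.
rewrite /dgen [X in _ - _ *: X]big1 => [|k pk]; last first.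
  case: (unliftP ord0 k) pk => [j ->|-> /=]; first by rewrite abelian scale0r.
  by rewrite (negbTE p0).
rewrite scaler0 subr0 big_ord_recl [X in _ + X]big1 ?addr0 => [|k _].
  rewrite big_mkcond big_ord_recl /= add0r; apply: eq_bigr => l _.
  by rewrite (negbTE p0) expr0 mul1r.
apply: big1 => l; case: (unliftP ord0 l) => [j ->|-> //] _.
by rewrite abelian mulr0 scale0r.
Qed.

Lemma wedge_dgen_emb k i (t : k.-tuple 'I_N) : normal q t ->
  wedge (dgen g (lift ord0 i)) (monom F p (emb t)) =
  - wedge gen0 (incl (wedge (coad0 g i) (monom F q t))).
Proof.
move=> nt; have net : normal p (map (lift ord0) t) by rewrite normal_emb.
rewrite dgen_lift /coad0 wedgeNl !wedge_suml (linearN (@incl F N g (1 + k))).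
rewrite linearN opprK (linear_sum (@incl F N g (1 + k))) (linear_sum (wedge gen0)).
apply: eq_bigr => l _; rewrite !linearZ /=.
congr (_ *: _); rewrite [in RHS]wedge_gen_normal // (incl_monom [tuple of l :: t]).
rewrite wedge_gen0_emb [X in wedge X _]wedge_gen_normal //.
rewrite /wedge linext_normal // linext_normal //.
by congr monom; apply/val_inj.
Qed.

(** Moving x_0^* to the front past x_i^* costs a sign, which turns the antiderivation rule into the
    derivation rule for D = - [der coad0]. *)
Lemma antider_monom_emb k (t : k.-tuple 'I_N) : normal q t ->
  antider_monom (dgen g) (emb t) =
  wedge gen0 (incl (- der_monom (coad0 g) t)).
Proof.
elim: k t => [|k IH] t; first by rewrite /= oppr0 !linear0.
case/tupleP: t => i t nit; have nt := normal_behead nit.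
have -> : emb [tuple of i :: t] = [tuple of lift ord0 i :: emb t] by apply/val_inj.
rewrite antider_monom_cons der_monom_cons IH // wedge_gen_gen0 //.
rewrite wedge_dgen_emb // [wedge (gen F q i) (- _)]linearN.
rewrite opprK opprD (linearD (@incl F N g k.+1)) (linearD (wedge gen0)) /=.
by rewrite !(linearN (@incl F N g k.+1)) /= !(linearN (wedge gen0)).
Qed.

Lemma diff_incl k (x : extI k) : diff g k (incl x) = wedge gen0 (incl (Dmap g k x)).
Proof.
elim/ext_ind: x => [a x y IHx IHy||t nt].
- by rewrite !linearP /= IHx IHy.
- by rewrite !linear0.
rewrite incl_monom antider_normal ?normal_emb // antider_monom_emb //.
by rewrite /Dmap opp_lfunE der_normal.
Qed.

Lemma diff_wedge0 k (z : extI k) : diff g k.+1 (wedge gen0 (incl z)) = 0.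
Proof.
elim/ext_ind: z => [a x y IHx IHy||t nt].
- by rewrite !linearP /= IHx IHy scaler0 addr0.
- by rewrite !linear0.
rewrite incl_monom wedge_gen0_emb antider_normal ?normal_ord0_emb //.
rewrite antider_monom_cons dgen_ord0 antider_monom_emb // wedge_gen0_gen0 // subr0.
by rewrite /wedge linear0.
Qed.

(** * Splitting off the multiples of x_0^* *)

Lemma normal_trans : transitive (fun i j : 'I_N.+1 => (i < j)%N || (i == j) && p i).
Proof.
move=> j i l /orP[ij|/andP[/eqP -> //]] /orP[jl|/andP[/eqP <- _]].
  by rewrite (ltn_trans ij).
by rewrite ij.
Qed.

Lemma all_gt0_emb k (u : k.-tuple 'I_N.+1) :
  all (fun j : 'I_N.+1 => 0 < j)%N u -> exists t : k.-tuple 'I_N, u = emb t.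
Proof.
elim: k u => [|k IH] u; first by exists [tuple]; rewrite [u]tuple0; apply: val_inj.
case/tupleP: u => i u /= /andP[i0 /IH[t ->]].
case: (unliftP ord0 i) i0 => [j ->|-> //] _.
by exists [tuple of j :: t]; apply: val_inj.
Qed.

Lemma normal_cases k (u : k.+1.-tuple 'I_N.+1) : normal p u ->
  (exists2 t : k.+1.-tuple 'I_N, normal q t & u = emb t) \/
  (exists2 t : k.-tuple 'I_N, normal q t & u = [tuple of ord0 :: emb t]).
Proof.
case/tupleP: u => i u nu; have := order_path_min normal_trans nu.
case: (posnP i) => [i0|i0] iu.
  have {}i0 : i = ord0 by apply: val_inj.
  right; case: (@all_gt0_emb _ u) => [|t ut].
    by apply: sub_all iu => j; rewrite i0 (negbTE p0) andbF orbF.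
  exists t; last by rewrite i0 ut.
  by rewrite -normal_ord0_emb; move: nu; rewrite ut i0.
left; case: (@all_gt0_emb _ [tuple of i :: u]) => [|t ut].
  rewrite /= i0; apply: sub_all iu => j /orP[|/andP[/eqP <- //]].
  exact: ltn_trans.
by exists t; rewrite // -normal_emb; move: nu; rewrite ut.
Qed.

Lemma normal_emb_tuple k (s : mono q k) : normal p (emb (val s)).
Proof. by rewrite normal_emb (valP s). Qed.

Lemma normal_ord0_tuple k (s : mono q k) : normal p [tuple of ord0 :: emb (val s)].
Proof. by move: (valP s); rewrite -normal_ord0_emb. Qed.

(* Coordinates of y = incl x + x_0^* ^ incl z: x is projI y and z is proj0 y. *)
Definition projI k (y : ext k) : extI k :=
  [ffun s : mono q k => y (exist _ (emb (val s)) (normal_emb_tuple s))].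

Definition proj0 k : ext k -> extpred F q k :=
  match k with
  | 0 => fun=> 0
  | k'.+1 => fun y =>
      [ffun s : mono q k' =>
         y (exist _ [tuple of ord0 :: emb (val s)] (normal_ord0_tuple s))]
  end.

#[local] Arguments proj0 : simpl never.
#[local] Arguments wedge0 : simpl never.

Fact projI_linear k : linear (@projI k).
Proof. by move=> a x y; apply/ffunP => s; rewrite !ffunE. Qed.

HB.instance Definition _ k :=
  GRing.isLinear.Build F (ext k) (extI k) _ (@projI k) (@projI_linear k).

Fact proj0_linear k : linear (@proj0 k).
Proof.
case: k => [|k] a x y; first by rewrite scaler0 addr0.
by apply/ffunP => s; rewrite !ffunE.
Qed.

HB.instance Definition _ k :=
  GRing.isLinear.Build F (ext k) (extpred F q k) _ (@proj0 k) (@proj0_linear k).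

Fact wedge0_linear k : linear (@wedge0 F N g k).
Proof.
case: k => [|k] a x y; first by rewrite /= scaler0 addr0.
by rewrite /wedge0 !linearP.
Qed.

HB.instance Definition _ k :=
  GRing.isLinear.Build F (extpred F q k) (ext k) _ (@wedge0 F N g k)
    (@wedge0_linear k).

Lemma eq_emb k (s t : k.-tuple 'I_N) : (emb s == emb t) = (s == t).
Proof. exact: (inj_eq (inj_map lift_inj)). Qed.

Lemma ord0_emb_neq k (s : k.-tuple 'I_N) (t : k.+1.-tuple 'I_N) :
  ([tuple of ord0 :: emb s] == emb t) = false.
Proof. by case/tupleP: t => i t; apply/eqP => /(congr1 val). Qed.

Lemma projI_incl k (x : extI k) : projI (incl x) = x.
Proof.
elim/ext_ind: x => [a x y IHx IHy||t nt].
- by rewrite !linearP /= IHx IHy.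
- by rewrite !linear0.
rewrite incl_monom !monom_normal ?normal_emb //.
by apply/ffunP => s; rewrite !ffunE /= eq_emb.
Qed.

Lemma proj0_incl k (x : extI k) : proj0 (incl x) = 0.
Proof.
case: k x => // k x; elim/ext_ind: x => [a x y IHx IHy||t nt].
- by rewrite !linearP /= IHx IHy scaler0 addr0.
- by rewrite !linear0.
rewrite incl_monom !monom_normal ?normal_emb //.
by apply/ffunP => s; rewrite !ffunE /= ord0_emb_neq.
Qed.

Lemma projI_wedge0 k (z : extpred F q k) : projI (wedge0 z) = 0.
Proof.
case: k z => [|k] z; first by rewrite linear0.
elim/ext_ind: z => [a x y IHx IHy||t nt].
- by rewrite !linearP /= IHx IHy scaler0 addr0.
- by rewrite !linear0.
rewrite /wedge0 incl_monom wedge_gen0_emb monom_normal ?normal_ord0_emb //.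
by apply/ffunP => s; rewrite !ffunE /= eq_sym ord0_emb_neq.
Qed.

Lemma proj0_wedge0 k (z : extpred F q k) : proj0 (wedge0 z) = z.
Proof.
(* In degree 0 the component [extpred] is the space of rows of length 0, where all elements are
   equal. *)
case: k z => [|k] z; first by apply/rowP => -[].
elim/ext_ind: z => [a x y IHx IHy||t nt].
- by rewrite !linearP /= IHx IHy.
- by rewrite !linear0.
rewrite /wedge0 incl_monom wedge_gen0_emb !monom_normal ?normal_ord0_emb //.
by apply/ffunP => s; rewrite !ffunE /= -eq_emb -!val_eqE /= eqseq_cons eqxx.
Qed.

Lemma projK k (y : ext k) : incl (projI y) + wedge0 (proj0 y) = y.
Proof.
elim/ext_ind: y => [a x y IHx IHy||u nu].
- by rewrite !linearP /= -[in RHS]IHx -[in RHS]IHy scalerDr addrACA.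
- by rewrite !linear0 addr0.
case: k u nu => [|k] u nu.
  have -> : u = emb [tuple] by rewrite [u]tuple0; apply: val_inj.
  by rewrite -incl_monom projI_incl addr0.
case: (normal_cases nu) => -[t nt ->].
  by rewrite -incl_monom projI_incl proj0_incl linear0 addr0.
rewrite -wedge_gen0_emb -incl_monom -[wedge _ _]/(wedge0 (k := k.+1) _).
by rewrite projI_wedge0 proj0_wedge0 linear0 add0r.
Qed.

(** * Cocycles and coboundaries in terms of D *)

Lemma cocycle_incl k (x : extI k) :
  (incl x \in cocycles g k) = (x \in lker (Dmap g k)).
Proof.
rewrite !memv_ker diff_incl -[wedge _ _]/(wedge0 (k := k.+1) _).
(* [proj0] is a left inverse of [wedge0], so x_0^* ^ D x = 0 forces D x = 0. *)
apply/eqP/eqP => [/(congr1 (@proj0 k.+1))|->]; last by rewrite linear0.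
by rewrite proj0_wedge0 linear0.
Qed.

Lemma cocycle_wedge0 k (z : extpred F q k) : wedge0 z \in cocycles g k.
Proof.
rewrite memv_ker; case: k z => [|k] z; first by rewrite linear0.
by rewrite /wedge0 diff_wedge0.
Qed.

Lemma cocycle_projI k (y : ext k) :
  y \in cocycles g k -> projI y \in lker (Dmap g k).
Proof.
by rewrite -cocycle_incl -{1}[y]projK addrC rpredDl ?cocycle_wedge0.
Qed.

Lemma diff_projI k (y : ext k) :
  diff g k y = wedge0 (k := k.+1) (Dmap g k (projI y)).
Proof.
rewrite -{1}[y]projK linearD /= diff_incl -[RHS]addr0; congr (_ + _).
by apply/eqP; rewrite -memv_ker cocycle_wedge0.
Qed.

Lemma coboundaryP k (y : ext k) :
  reflect (exists2 z, z \in limg (Dpred g k) & y = wedge0 z)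
          (y \in coboundaries g k).
Proof.
case: k y => [|k] y; rewrite /coboundaries; apply: (iffP idP).
- by move=> /memv_imgP[w _ ->]; exists 0; rewrite ?mem0v // linear0 lfunE.
- by case=> z /memv_imgP[w _ ->] ->; rewrite lfunE linear0 mem0v.
- case/memv_imgP=> w _ ->; exists (Dmap g k (projI w)); last exact: diff_projI.
  exact: memv_img (memvf _).
- case=> z /memv_imgP[w _ ->] ->; apply/memv_imgP; exists (incl w); first exact: memvf.
  by rewrite /= diff_incl.
Qed.

(** * The isomorphism with Ker D plus Coker D *)

Section Isomorphism.
Variable k : nat.

Local Notation K := (lker (Dmap g k)).
Local Notation B := (limg (Dpred g k)).

(** Made total and linear by first projecting onto the cocycles; it is the class of [y] when [y] is
    a cocycle. *)
Definition cohomology_class (y : ext k) : cohomology g k :=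
  vproj _ (vsproj (cocycles g k) y).

Fact cohomology_class_linear : linear cohomology_class.
Proof. by move=> a x y; rewrite /cohomology_class !linearP. Qed.

HB.instance Definition _ := GRing.isLinear.Build F (ext k) (cohomology g k) _
  cohomology_class cohomology_class_linear.

Lemma cohomology_class_eq y1 y2 :
  y1 \in cocycles g k -> y2 \in cocycles g k ->
  (cohomology_class y1 == cohomology_class y2) = (y1 - y2 \in coboundaries g k).
Proof.
by move=> y1c y2c; rewrite vprojE -memv_preim lfunE /= !vsprojK.
Qed.

Lemma cohomology_classK (h : cohomology g k) :
  cohomology_class (vsval (repr h)) = h.
Proof. by rewrite /cohomology_class vsvalK vprojK. Qed.

Lemma is_class_cohomology_class y :
  y \in cocycles g k -> is_class (cohomology_class y) y.
Proof. by move=> yc; exists (vsproj (cocycles g k) y); rewrite vsprojK. Qed.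

(** Two representatives differ by an element of Im D, and x_0^* ^ Im D consists of coboundaries; so
    the map on the quotient is well defined. *)
Lemma cohomology_class_wedge0_repr z :
  cohomology_class (wedge0 (repr (vproj B z))) = cohomology_class (wedge0 z).
Proof.
apply/eqP; rewrite cohomology_class_eq ?cocycle_wedge0 // -linearB /=.
apply/coboundaryP; exists (repr (vproj B z) - z) => //.
by rewrite -vprojE vprojK.
Qed.

Definition ker_coker_class (u : subvs_of K * vquot B) : cohomology g k :=
  cohomology_class (incl (vsval u.1)) + cohomology_class (wedge0 (repr u.2)).

Definition class_ker_coker (h : cohomology g k) : subvs_of K * vquot B :=
  (vsproj K (projI (vsval (repr h))), vproj B (proj0 (vsval (repr h)))).

Fact ker_coker_class_linear : linear ker_coker_class.
Proof.
move=> a [x q1] [y q2]; rewrite /ker_coker_class /=.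
rewrite -[q1]vprojK -[q2]vprojK -(linearP (@vproj F _ B)) !cohomology_class_wedge0_repr.
by rewrite !linearP /= scalerDr addrACA.
Qed.

Lemma ker_coker_classK : cancel ker_coker_class class_ker_coker.
Proof.
case=> x q1; rewrite /class_ker_coker; set h := ker_coker_class _.
have hE : h = cohomology_class (incl (vsval x) + wedge0 (repr q1)).
  by rewrite linearD.
have /eqP := hE; rewrite -{1}[h]cohomology_classK cohomology_class_eq ?subvsP //; last first.
  by rewrite rpredD ?cocycle_wedge0 // cocycle_incl subvsP.
(* The representative chosen for [h] differs from the expected cocycle by x_0^* ^ z with z in Im D:
   [projI] does not see this, and [proj0] changes by z, which is 0 in the quotient. *)
case/coboundaryP=> z zB /(canRL (subrK _)) ->.
rewrite !(linearD (@projI k)) !(linearD (@proj0 k)) /=.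
rewrite !projI_wedge0 !proj0_wedge0 projI_incl proj0_incl.
rewrite !(add0r, addr0) vsvalK; congr (_, _); apply/eqP.
by rewrite -[X in _ == X]vprojK vprojE addrK.
Qed.

Lemma class_ker_cokerK : cancel class_ker_coker ker_coker_class.
Proof.
move=> h; rewrite /ker_coker_class /= cohomology_class_wedge0_repr.
rewrite vsprojK ?cocycle_projI ?subvsP // -linearD /= projK.
exact: cohomology_classK.
Qed.

End Isomorphism.

Theorem abelian_ideal_cohomology k :
  exists f : {linear (subvs_of (lker (Dmap g k)) * vquot (limg (Dpred g k)))%type
                     -> cohomology g k},
    [/\ bijective f,
        (forall x, is_class (f (x, 0)) (incl (vsval x))) &
        (forall z, is_class (f (0, vproj _ z)) (wedge0 z))].
Proof.
pose m := GRing.isLinear.Build _ _ _ _ _ (@ker_coker_class_linear k).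
pose f : {linear _ -> _} := HB.pack (@ker_coker_class k) m.
exists f; split=> [|x|z].
- exact: Bijective (@ker_coker_classK k) (@class_ker_cokerK k).
- rewrite /f /= /ker_coker_class /=.
  (* The representative [repr] picks for the zero class may be any element of Im D, but its
     contribution to cohomology is zero. *)
  have := cohomology_class_wedge0_repr (0 : extpred F q k).
  rewrite (linear0 (@vproj F _ _)) => ->; rewrite !linear0 addr0.
  by apply: is_class_cohomology_class; rewrite cocycle_incl subvsP.
- rewrite /f /= /ker_coker_class /= cohomology_class_wedge0_repr !linear0 add0r.
  exact/is_class_cohomology_class/cocycle_wedge0.
Qed.

End AbelianIdeal.
End Hyperplane.

Theorem lemma3p1 (F : closedFieldType) (charF0 : [pchar F] =i pred0)
    (n m : nat) (n_gt0 : (0 < n)%N) (m_gt0 : (0 < m)%N) (k : nat) :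
  exists f : {linear (subvs_of (lker (Dmap (model F n m) k))
                      * vquot (limg (Dpred (model F n m) k)))%type
                     -> cohomology (model F n m) k},
    [/\ bijective f,
        (forall x : subvs_of (lker (Dmap (model F n m) k)),
           is_class (f (x, 0)) (incl (vsval x))) &
        (forall z : extpred F (parI (model F n m)) k,
           is_class (f (0, vproj _ z)) (wedge0 z))].
Proof.
(* Evenness of X_0 holds by computation, since its index 0 is not above [n]. *)
apply: abelian_ideal_cohomology => //.
- exact: model_ideal.
- exact: model_abelian.
Qed.
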